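(* Let $Q,P_{\max},P_p,\sigma^2,\overline g,\overline h,\overline q>0$ be constants. Let $g,h,q$ be independent exponential random variables with means $\overline g,\overline h,\overline q$ respectively, and let $$\gamma=\min\left\{\frac{Q\,g}{h\,(P_p q+\sigma^2)},\ \frac{P_{\max}\,g}{P_p q+\sigma^2}\right\}.$$ Then the cumulative distribution function $F_{\gamma}$ of $\gamma$ belongs to the maximum domain of attraction of the Gumbel distribution.
   Context: $\gamma$ is the received signal to interference plus noise ratio at a secondary receiver when one given antenna of the secondary transmitter is used with transmit power $\min\{Q/h,P_{\max}\}$. The $N$ antennas have identically distributed gains, so the distribution is the same for each antenna. A cumulative distribution function $F$ belongs to the maximum domain of attraction of the Gumbel distribution if there exist real constants $a_N$ and $b_N>0$ ($N=1,2,\dots$) such that, for every $x\in\mathbb R$, $\lim_{N\to\infty}[F(a_N+b_N x)]^N=\exp(-e^{-x})$. Equivalently, if $M_N$ is the maximum of $N$ i.i.d. random variables with distribution function $F$, then $(M_N-a_N)/b_N$ converges in distribution to the law with CDF $\exp(-e^{-x})$. Explicitly, for $x>0$, $$F_{\gamma}(x)=1-\frac{Q\overline g}{xP_p\overline q\,\overline h}\,e^{\frac{\sigma^2}{P_p\overline q}+\frac{Q\overline g}{xP_p\overline q\,\overline h}}\,\Gamma\!\left[0,\left(\frac{x}{\overline gP_{\max}}+\frac1{P_p\overline q}\right)\left(\frac{Q\overline g}{x\overline h}+\sigma^2\right)\right]-\left[1-e^{-\frac{Q}{\overline hP_{\max}}}\right]\frac{\overline gP_{\max}}{xP_p\overline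 q+\overline gP_{\max}}\,e^{-\frac{x\sigma^2}{\overline gP_{\max}}},$$ where $\Gamma(a,b)=\int_b^\infty e^{-t}t^{a-1}\,dt$. *)

(* Defs.v *)
From HB Require Import structures.
From mathcomp Require Import all_boot all_order all_algebra.
From mathcomp Require Import all_classical all_reals all_analysis.
From mathcomp Require Import measurable_realfun.

Set Implicit Arguments.
Unset Strict Implicit.
Unset Printing Implicit Defensive.

Import Order.TTheory GRing.Theory Num.Theory.
Import numFieldNormedType.Exports.

Local Open Scope classical_set_scope.
Local Open Scope ring_scope.

(* The rate of an exponential law is the inverse of its mean. *)
Definition exponential_RV d (T : measurableType d) (R : realType)
    (P : probability T R) (X : {RV P >-> R}) (mean : R) : Prop :=
  forall A : set R, measurable A ->
    distribution P X A = exponential_prob mean^-1 A.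

Definition mutually_independent_RVs d (T : measurableType d) (R : realType)
    (P : probability T R) (n : nat) (X : n.-tuple {RV P >-> R}) : Prop :=
  forall (J : {set 'I_n}) (B : 'I_n -> set R), (forall i, measurable (B i)) ->
    P (\bigcap_(i in [set` J]) (tnth X i @^-1` B i)) =
    (\prod_(i in J) P (tnth X i @^-1` B i))%E.

Definition gumbel_max_domain (R : realType) (F : R -> R) : Prop :=
  exists a b : nat -> R,
    (forall N, (0 < N)%N -> 0 < b N) /\
    forall x : R,
      F (a N + b N * x) ^+ N @[N --> \oo] --> expR (- expR (- x)).

Lemma measurable_invr (R : realType) :
  measurable_fun [set: R] (fun x : R => x^-1).
Proof.
have -> : [set: R] = [set 0] `|` ~` [set 0] by rewrite setUv.
apply/measurable_funU => //; first exact: measurableC.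
split; first exact: measurable_fun_set1.
apply: open_continuous_measurable_fun.
  by apply: closed_openC; exact: closed_eq.
by move=> x /set_mem /eqP; exact: inv_continuous.
Qed.

Section sinr.
Context d (T : measurableType d) (R : realType) (P : probability T R).
Variables (Q Pmax Pp sigma2 : R) (g h q : {RV P >-> R}).

(* Division by 0 returns 0; for exponential gains the denominators vanish only
   on a null set. *)
Definition sinr (w : T) : R :=
  Num.min (Q * g w / (h w * (Pp * q w + sigma2)))
          (Pmax * g w / (Pp * q w + sigma2)).

Lemma measurable_sinr : measurable_fun [set: T] sinr.
Proof.
have mI : measurable_fun [set: T] (fun w => Pp * q w + sigma2).
  by apply: measurable_funD => //; exact: measurable_funM.
apply: measurable_minr; apply: measurable_funM.
- exact: measurable_funM.
- apply: (measurableT_comp (@measurable_invr R)); exact: measurable_funM.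
- exact: measurable_funM.
- exact: (measurableT_comp (@measurable_invr R)).
Qed.

HB.instance Definition _ :=
  isMeasurableFun.Build _ _ _ _ sinr measurable_sinr.

End sinr.

(* Main.v *)
(* The tail S of the ratio satisfies x e^(lx) S(x) --> C > 0 as x --> +oo, with
   l = sigma2 / (gbar Pmax); this is enough for the Gumbel domain, with b_N = 1 / l
   and a_N solving a e^(la) = C N, since then N S(a_N + x / l) --> e^(-x).
   For the tail, condition on h. When h <= h0 := Q / Pmax the second term of the
   minimum is the active one, and its tail is an explicit exponential times a
   Laplace transform of q. The event h > h0 + t contributes a term with the
   strictly larger rate l (1 + t / h0); taking t = 1 / sqrt x makes it negligible
   while the probability of h0 < h <= h0 + t still tends to 0. *)

From HB Require Import structures.
Require Import Defs.
From mathcomp Require Import all_boot all_order all_algebra.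
From mathcomp Require Import all_classical all_reals all_analysis.
From mathcomp Require Import measurable_realfun ring.

Set Implicit Arguments.
Unset Strict Implicit.
Unset Printing Implicit Defensive.

Import Order.TTheory GRing.Theory Num.Theory.
Import numFieldNormedType.Exports.

Local Open Scope classical_set_scope.
Local Open Scope ring_scope.

(** * Gumbel domain from an asymptotic of the tail *)

Lemma cvg_exprn_1B (R : realType) (s : nat -> R) (l : R) :
  (forall n, 0 <= s n) -> n%:R * s n @[n --> \oo] --> l ->
  (1 - s n) ^+ n @[n --> \oo] --> expR (- l).
Proof.
move=> s0 nsl.
have s_cvg0 : s n @[n --> \oo] --> 0.
  have : n%:R^-1 * (n%:R * s n) @[n --> \oo] --> 0 * l.
    apply: cvgM nsl; apply/gtr0_cvgV0; last exact: cvgr_idn.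
    by near=> n; rewrite ltr0n; near: n; exact: nbhs_infty_gt.
  rewrite mul0r; apply: cvg_trans; apply: near_eq_cvg; near=> n.
  rewrite mulrA mulVf ?mul1r// pnatr_eq0 -lt0n.
  by near: n; exact: nbhs_infty_gt.
(* For s = [s n] < 1, [1 - s <= e^(-s)] bounds from above, and [1 / (1 - s) = 1 + s / (1 - s) <=
   e^(s / (1 - s))] bounds from below after inversion; then take n-th powers. *)
apply: (@squeeze_cvgr _ _ _ _ (fun n => expR (- (n%:R * s n / (1 - s n))))
  (fun n => expR (- (n%:R * s n)))).
- near=> n.
  have sn1 : s n < 1 by near: n; exact: (cvgr_lt 0).
  have t0 : 0 < 1 - s n by rewrite subr_gt0.
  apply/andP; split; last first.
    rewrite -mulrN mulrC expRM_natr lerXn2r ?nnegrE ?expR_ge0 ?(ltW t0)//.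
    exact: expR_ge1Dx.
  rewrite -mulrA -mulrN mulrC expRM_natr lerXn2r ?nnegrE ?expR_ge0 ?(ltW t0)//.
  rewrite expRN -[leRHS]invrK lef_pV2 ?posrE ?invr_gt0 ?expR_gt0//.
  apply: le_trans (expR_ge1Dx _).
  by rewrite le_eqVlt; apply/orP; left; apply/eqP; field; rewrite gt_eqF.
- apply: continuous_cvg; first exact: continuous_expR.
  apply: cvgN; rewrite -[X in _ --> X]divr1; apply: cvgM => //.
  apply: cvgV; first by rewrite oner_eq0.
  by rewrite -[X in _ --> X]subr0; apply: cvgB => //; exact: cvg_cst.
- by apply: continuous_cvg; [exact: continuous_expR|exact: cvgN].
Unshelve. all: end_near. Qed.

(** Supplies the centring constants. The intermediate value theorem applies on [[0, y]] because
    [e^(l y) >= 1]. *)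
Lemma mul_expR_onto (R : realType) (l y : R) : 0 < l -> 0 <= y ->
  exists2 x, 0 <= x & x * expR (l * x) = y.
Proof.
move=> l0 y0.
have [||c] := @IVT R (fun x => x * expR (l * x)) 0 y y y0.
- apply: continuous_subspaceT => x.
  apply: cvgM; first exact: cvg_id.
  apply: continuous_comp; last exact: continuous_expR.
  by apply: cvgM; [exact: cvg_cst|exact: cvg_id].
- have yf : y <= y * expR (l * y).
    by rewrite ler_peMr// -expR0 ler_expR mulr_ge0// ltW.
  by rewrite mul0r min_l ?max_r ?y0//= (le_trans y0).
- by rewrite in_itv/= => /andP[c0 _] <-; exists c.
Qed.

Lemma gumbel_max_domain_tail (R : realType) (F : R -> R) (l C : R) :
  0 < l -> 0 < C -> (forall x, F x <= 1) ->
  x * expR (l * x) * (1 - F x) @[x --> +oo] --> C -> gumbel_max_domain F.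
Proof.
move=> l0 C0 F1 FC.
have /choice[a a_def] N : exists x : R, 0 <= x /\ x * expR (l * x) = C * N%:R.
  have [|x x0 xE] := @mul_expR_onto R l (C * N%:R) l0; last by exists x.
  by rewrite mulr_ge0// ltW.
have a_y : a n @[n --> \oo] --> +oo.
  (* If [a n < A], then [C n = a n * e^(l a n)] is at most the constant [A * e^(l A)], which fails
     for large n. *)
  apply/cvgryPge => A; near=> n; rewrite leNgt; apply/negP => aA.
  have [a0 aE] := a_def n.
  have : C * n%:R <= A * expR (l * A).
    rewrite -aE ler_pM ?expR_ge0// ?ltW//.
    by rewrite ltr_expR ltr_pM2l.
  apply/negP; rewrite -ltNge -ltr_pdivrMl//.
  by near: n; exact: nbhs_infty_gtr.
exists a, (fun=> l^-1); split=> [_ _|x]; first by rewrite invr_gt0.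
pose y n := a n + l^-1 * x.
have y_y : y n @[n --> \oo] --> +oo.
  apply/cvgryPge => A; near=> n; rewrite /y -lerBlDr.
  by near: n; move/cvgryPge : a_y; exact.
under eq_fun => n do rewrite -[F _](subKr 1).
apply: cvg_exprn_1B => [n|]; first by rewrite subr_ge0.
have /(_ y y_y) Fy := (cvg_pinftyP _ _).1 FC.
(* This factor is [a n / y n], so shifting by [x / l] does not change the polynomial factor in the
   limit. *)
have ay : (1 + l^-1 * x * (a n)^-1)^-1 @[n --> \oo] --> (1 + l^-1 * x * 0)^-1.
  apply: cvgV; first by rewrite mulr0 addr0 oner_eq0.
  apply: cvgD; first exact: cvg_cst.
  apply: cvgM; first exact: cvg_cst.
  apply/gtr0_cvgV0 => //; near=> n.
  by near: n; move/cvgryPgt : a_y; exact.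
(* The product equals [n * (1 - F (y n))] for large n: substitute [n = a n * e^(l a n) / C] and
   [e^(l y n) = e^(l a n) * e^x]. *)
have : y n * expR (l * y n) * (1 - F (y n)) * (1 + l^-1 * x * (a n)^-1)^-1 *
    (expR (- x) / C) @[n --> \oo]
    --> C * (1 + l^-1 * x * 0)^-1 * (expR (- x) / C).
  by apply: cvgM; [exact: cvgM|exact: cvg_cst].
rewrite mulr0 addr0 invr1 mulr1 mulrCA mulfV ?gt_eqF// mulr1.
apply: cvg_trans; apply: near_eq_cvg; near=> n.
have an0 : 0 < a n by near: n; move/cvgryPgt : a_y; exact.
have yn0 : 0 < y n by near: n; move/cvgryPgt : y_y; exact.
have nE : n%:R = a n * expR (l * a n) / C.
  by rewrite (a_def n).2 mulrAC mulfV ?gt_eqF// mul1r.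
have yE : y n = a n * (1 + l^-1 * x * (a n)^-1) by rewrite /y; field; rewrite !gt_eqF.
have z0 : 0 < 1 + l^-1 * x * (a n)^-1 by move: yn0; rewrite yE pmulr_rgt0.
have -> : expR (l * y n) = expR (l * a n) * expR x.
  by rewrite -expRD /y mulrDr mulVKf ?gt_eqF.
rewrite nE -/(y n) expRN; move: (1 - F (y n)) => S; rewrite yE.
move: (1 + _) z0 => z z0.
by field; rewrite !gt_eqF ?expR_gt0.
Unshelve. all: end_near. Qed.

(** * Exponential laws: distribution function, density and Laplace transform *)

Lemma measurable_expRNM (R : realType) (a : R) :
  measurable_fun [set: R] (fun x => expR (- (a * x))).
Proof.
apply: (measurableT_comp (@measurable_expR R)).
apply: (measurableT_comp (@oppr_measurable R [set: R])).
exact: measurable_funM.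
Qed.

Section exponential_RV.
Context (d : measure_display) (T : measurableType d) (R : realType)
  (P : probability T R).
Variables (X : {RV P >-> R}) (m : R).
Hypotheses (m_gt0 : 0 < m) (expX : exponential_RV X m).

Let im_gt0 : 0 < m^-1. Proof. by rewrite invr_gt0. Qed.

Lemma exponential_RV_lt0 : distribution P X `]-oo, 0[ = 0%E.
Proof.
rewrite expX// /exponential_prob integral0_eq// => x /=.
by rewrite in_itv/= => x0; rewrite lt0_exponential_pdf.
Qed.

Lemma exponential_RV_le0 : distribution P X `]-oo, 0] = 0%E.
Proof.
rewrite -(@setUitv1 _ _ _ _ true)//; apply: null_set_setU => //.
  exact: exponential_RV_lt0.
by rewrite [LHS]expX// /exponential_prob integral_set1.
Qed.

Lemma exponential_RV_le t : 0 < t ->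
  distribution P X `]-oo, t] = (1 - expR (- t / m))%:E.
Proof.
move=> t0; have -> : `]-oo, t]%classic = `]-oo, 0[ `|` `[0, t].
  by rewrite -itv_bndbnd_setU// bnd_simp ltW.
rewrite measureU//; last first.
  by rewrite -subset0 => x /= []; rewrite !in_itv/= => + /andP[]; case: ltP.
rewrite [X in (X + _)%E]exponential_RV_lt0 add0e [LHS]expX//.
by rewrite exponential_prob_itv0c// EFinB mulrC mulrN mulNr.
Qed.

Lemma exponential_RV_gt t : 0 < t ->
  distribution P X `]t, +oo[ = (expR (- t / m))%:E.
Proof.
move=> t0; rewrite -[LHS]/(ccdf X t) ccdf_1_cdf /cdf exponential_RV_le//.
by rewrite -EFinB subKr.
Qed.

(* [lebesgue_measure] lives on [measurableTypeR R], which has the same measurable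
   sets as [R] but another display, so Radon-Nikodym does not apply to [X] itself. *)
Let X' : T -> measurableTypeR R := X.

Let measurable_X' : measurable_fun [set: T] X'.
Proof. exact: (@measurable_funPT _ _ _ _ X). Qed.

HB.instance Definition _ := isMeasurableFun.Build _ _ _ _ X' measurable_X'.

Let exponential_RV_dom : distribution P X' `<< @lebesgue_measure R.
Proof.
apply/null_content_dominatesP => A mA muA0; rewrite [LHS]expX//.
apply: null_set_integral => //.
apply/measurable_EFinP/measurable_funTS; exact: measurable_exponential_pdf.
Qed.

(** The Radon-Nikodym derivative of the law and the exponential density have the same integral over
    every measurable set, hence agree almost everywhere. Finiteness of the integral gives the
    integrability that the change of variables asks for. *)
Lemma ge0_integral_exponential_RV (f : R -> \bar R) :
  measurable_fun [set: R] f -> (forall x, 0 <= f x)%E ->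
  (\int[distribution P X]_x f x < +oo)%E ->
  (\int[distribution P X]_x f x =
   \int[lebesgue_measure]_x (f x * (exponential_pdf m^-1 x)%:E))%E.
Proof.
move=> mf f0 foo.
have fE : (\int[distribution P X]_x f x = \int[distribution P X']_x f x)%E.
  by rewrite !ge0_integral_distribution.
rewrite fE -(Radon_Nikodym_change_of_variables exponential_RV_dom)//=; last first.
  apply/integrableP; split => //.
  by under eq_integral => x _ do rewrite gee0_abs//; rewrite -fE.
have mpdf : measurable_fun [set: R] (EFin \o exponential_pdf m^-1).
  by apply/measurable_EFinP; exact: measurable_exponential_pdf.
apply: ae_eq_integral => //.
- by apply: emeasurable_funM => //; apply: (measurable_int lebesgue_measure);
    apply: Radon_Nikodym_integrable; exact: exponential_RV_dom.
- exact: emeasurable_funM.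
- apply: ae_eqe_mul2l => /=.
  rewrite Radon_NikodymE//=; case: cid => /= k [k1 k2 k3].
  apply: integral_ae_eq => //=.
  by move=> E EU mE; rewrite -k3//= [LHS]expX.
Qed.

(** On the half-line, [e^(-a x)] times the density of rate [1 / m] is [(1 / m) / r] times the
    density of rate [r = 1 / m + a], which has mass 1. Restricting to [x >= 0] keeps the integrand
    bounded by 1 and loses no mass. *)
Lemma laplace_exponential_RV (a : R) : 0 <= a ->
  (\int[distribution P X]_(x in `[0%R, +oo[) (expR (- (a * x)))%:E =
   ((1 + a * m)^-1)%:E)%E.
Proof.
move=> a0.
have mexp := measurable_expRNM a.
rewrite integral_mkcond ge0_integral_exponential_RV; first last.
- apply: (@le_lt_trans _ _ (\int[distribution P X]_x cst 1%E x)%E); last first.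
    rewrite integral_cst// mul1e; apply: le_lt_trans (ltry 1).
    exact: probability_le1.
  apply: ge0_le_integral => //.
  + by move=> x _; apply: erestrict_ge0 => y _; rewrite lee_fin expR_ge0.
  + apply/(measurable_restrictT _ _).1 => //.
    by apply/measurable_EFinP; exact: measurable_funTS.
  + move=> x _; rewrite patchE; case: ifPn => // /set_mem/=.
    rewrite in_itv/= andbT => x0.
    by rewrite lee_fin -expR0 ler_expR oppr_le0 mulr_ge0.
- by move=> x; apply: erestrict_ge0 => y _; rewrite lee_fin expR_ge0.
- apply/(measurable_restrictT _ _).1 => //.
  by apply/measurable_EFinP; exact: measurable_funTS.
pose r := m^-1 + a.
have r0 : 0 < r by rewrite ltr_pwDl.
transitivity (\int[lebesgue_measure]_x
    ((m^-1 / r)%:E * (exponential_pdf r x)%:E))%E.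
  apply: eq_integral => x _.
  rewrite patchE -EFinM; case: ifPn => [|].
    rewrite inE/= in_itv/= andbT => x0; rewrite !exponential_pdfE// -EFinM.
    congr EFin; rewrite [in RHS]mulrA divfK ?gt_eqF// mulrCA -expRD.
    by congr (_ * expR _); rewrite /r; ring.
  rewrite notin_setE/= in_itv/= andbT => /negP; rewrite -ltNge => x0.
  by rewrite !lt0_exponential_pdf// mulr0 mule0.
rewrite ge0_integralZl//; first last.
- by rewrite lee_fin divr_ge0// ltW.
- by move=> x _; rewrite lee_fin exponential_pdf_ge0// ltW.
- by apply/measurable_EFinP; exact: measurable_exponential_pdf.
rewrite integral_exponential_pdf// mule1; congr EFin.
by rewrite /r; field; rewrite !gt_eqF// ltr_pwDl// mulr_ge0// ltW.
Qed.

End exponential_RV.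

(** * Independence and product measures *)

Lemma mutually_independent_RVs3 (d : measure_display) (T : measurableType d)
    (R : realType) (P : probability T R) (X Y Z : {RV P >-> R}) :
  mutually_independent_RVs [tuple X; Y; Z] ->
  forall A B C : set R, measurable A -> measurable B -> measurable C ->
  P (X @^-1` A `&` Y @^-1` B `&` Z @^-1` C) =
  (P (X @^-1` A) * P (Y @^-1` B) * P (Z @^-1` C))%E.
Proof.
move=> indep A B C mA mB mC.
have := indep (finset.setTfor 'I_3) (tnth [tuple A; B; C]).
rewrite (eq_bigl xpredT); last by move=> i; rewrite finset.in_setT.
rewrite !big_ord_recl/= big_ord0 mule1 muleA => <-.
  congr (P _); apply/seteqP; split => [w [[Aw Bw] Cw] i _|w H].
    by case: i => [[|[|[|//]]]] i3.
  have H0 := H ord0 (finset.in_setT _).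
  have H1 := H (lift ord0 ord0) (finset.in_setT _).
  have H2 := H (lift ord0 (lift ord0 ord0)) (finset.in_setT _).
  by split.
by case=> [[|[|[|//]]]] i3.
Qed.

(** The law of [(Z, X)] restricted to the event [Y \in B], and the product of the laws of [Z] and
    [X] weighted by the probability of that event, agree on rectangles; uniqueness of the product
    measure extends this to every measurable [A]. *)
Lemma independent_prod_measure (d : measure_display) (T : measurableType d)
    (R : realType) (P : probability T R) (X Y Z : {RV P >-> R}) :
  mutually_independent_RVs [tuple X; Y; Z] ->
  forall (B : set R) (A : set (R * R)), measurable B -> measurable A ->
  P (Y @^-1` B `&` (fun w => (Z w, X w)) @^-1` A) =
  (P (Y @^-1` B) * \int[distribution P Z]_z distribution P X (xsection A z))%E.
Proof.
move=> indep B A mB mA.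
pose W w := (Z w, X w).
have mW : measurable_fun [set: T] W by exact: measurable_fun_pair.
have mYB : measurable (Y @^-1` B) by exact: measurable_funPTI.
have PB0 : 0 <= fine (P (Y @^-1` B)) by rewrite fine_ge0.
pose m1 := mscale (NngNum PB0) (distribution P Z).
pose m' := pushforward (mrestr P mYB) W.
have m'E C D : measurable C -> measurable D ->
    m' (C `*` D) = (m1 C * distribution P X D)%E.
  move=> mC mD; rewrite /m1 /mscale/= fineK ?fin_num_measure//.
  rewrite muleC muleA -[RHS](mutually_independent_RVs3 indep)//.
  by congr (P _); apply/seteqP; split => w /= [[]].
transitivity (m' A); first by rewrite /m' /pushforward /mrestr setIC.
apply: etrans
  (esym (@product_measure_unique _ _ _ _ _ m1 (distribution P X) m' m'E A mA)) _.
  exact: mW.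
rewrite /product_measure1 /m1 ge0_integral_mscale//=.
  by rewrite fineK ?fin_num_measure.
exact: measurable_fun_xsection.
Qed.

(** * Tail of the ratio: two-sided bounds and asymptotics *)

Section sinr_tail.
Context (d : measure_display) (T : measurableType d) (R : realType)
  (P : probability T R).
Variables (Q Pmax Pp sigma2 gbar hbar qbar : R).
Hypotheses (Q_gt0 : 0 < Q) (Pmax_gt0 : 0 < Pmax) (Pp_gt0 : 0 < Pp)
  (sigma2_gt0 : 0 < sigma2)
  (gbar_gt0 : 0 < gbar) (hbar_gt0 : 0 < hbar) (qbar_gt0 : 0 < qbar).
Variables (g h q : {RV P >-> R}).
Hypotheses (exp_g : exponential_RV g gbar) (exp_h : exponential_RV h hbar)
  (exp_q : exponential_RV q qbar)
  (ghq_indep : mutually_independent_RVs [tuple g; h; q]).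

(** For [s = x / Pmax] the inequality says that the second ratio exceeds [x]; for
    [s = x * (h0 + t) / Q], that the first one does with [h0 + t] in place of [h]. The condition
    [0 <= q w] keeps the denominators positive and excludes only a null set. *)
Definition gain_event (s : R) : set T :=
  [set w | 0 <= q w /\ s * (Pp * q w + sigma2) < g w].

(** The probability of [gain_event s] for [s > 0]: the noise contributes the exponential, the
    interference the Laplace transform of [q] at [s * Pp / gbar]. *)
Definition gain_tail (s : R) : R :=
  expR (- (s * sigma2 / gbar)) / (1 + s * Pp / gbar * qbar).

Let gain_set (s : R) : set (R * R) :=
  [set zx | 0 <= zx.1 /\ s * (Pp * zx.1 + sigma2) < zx.2].

Let measurable_gain_set s : measurable (gain_set s).
Proof.
have -> : gain_set s = (fst @^-1` `[0, +oo[) `&`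
    ((fun zx : R * R => zx.2 - s * (Pp * zx.1 + sigma2)) @^-1` `]0, +oo[).
  apply/seteqP; split => zx /=; rewrite !in_itv/= !andbT subr_gt0.
    by move=> [-> ->].
  by move=> [].
apply: measurableI; first by rewrite -[X in measurable X]setTI; exact: measurable_fst.
rewrite -[X in measurable X]setTI.
have m1 : measurable_fun [set: R * R] (fun zx : R * R => s * (Pp * zx.1 + sigma2)).
  apply: measurable_funM => //; apply: measurable_funD => //.
  by apply: measurable_funM => //; exact: measurable_fst.
have m2 : measurable_fun [set: R * R]
    (fun zx : R * R => zx.2 - s * (Pp * zx.1 + sigma2)).
  by apply: measurable_funB => //; exact: measurable_snd.
exact: m2.
Qed.

Lemma measurable_gain_event (s : R) : measurable (gain_event s).
Proof.
have mW : measurable_fun [set: T] (fun w => (q w, g w)).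
  exact: measurable_fun_pair.
by have := mW measurableT _ (measurable_gain_set s); rewrite setTI.
Qed.

(** Given [q = z >= 0], the gain [g] exceeds the threshold with probability
    [e^(-s (Pp z + sigma2) / gbar)]; integrating over [z] leaves a Laplace transform, and [h]
    factors out by independence. *)
Lemma prob_gain_event (s : R) (H : set R) : 0 < s -> measurable H ->
  P (h @^-1` H `&` gain_event s) = (P (h @^-1` H) * (gain_tail s)%:E)%E.
Proof.
move=> s0 mH.
rewrite [LHS](independent_prod_measure ghq_indep mH (measurable_gain_set s)).
congr (_ * _)%E.
transitivity (\int[distribution P q]_(z in `[0%R, +oo[)
    ((expR (- (s * sigma2 / gbar)))%:E * (expR (- (s * Pp / gbar * z)))%:E))%E.
  rewrite [RHS]integral_mkcond; apply: eq_integral => z _; rewrite patchE.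
  case: ifPn => [/set_mem/=|]; rewrite ?notin_setE/= in_itv/= andbT => z0.
    have -> : xsection (gain_set s) z = `]s * (Pp * z + sigma2), +oo[%classic.
      apply/seteqP; split => x; first by move=> /xsectionP[_]; rewrite /= in_itv/= andbT.
      by rewrite /= in_itv/= andbT => sx; apply/xsectionP.
    rewrite (exponential_RV_gt exp_g); last first.
      by rewrite mulr_gt0// ltr_wpDl// mulr_ge0// ltW.
    by rewrite -EFinM -expRD; congr (expR _)%:E; field; rewrite gt_eqF.
  have -> : xsection (gain_set s) z = set0; last by rewrite measure0.
  by rewrite -subset0 => x /xsectionP[].
rewrite ge0_integralZl//; last first.
  by apply/measurable_EFinP/measurable_funTS; exact: measurable_expRNM.
rewrite (laplace_exponential_RV qbar_gt0 exp_q)// -?EFinM//.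
by rewrite divr_ge0 ?mulr_ge0 ?ltW.
Qed.

Let gamma : {RV P >-> R} := sinr Q Pmax Pp sigma2 g h q.
Let h0 := Q / Pmax.

Let h0_gt0 : 0 < h0. Proof. exact: divr_gt0. Qed.

Let inter_gt0 w : 0 <= q w -> 0 < Pp * q w + sigma2.
Proof. by move=> q0; rewrite ltr_wpDl// mulr_ge0// ltW. Qed.

(** For [0 < h <= h0] one has [Q / h >= Pmax], so the second ratio is the minimum and
    [gain_event (x / Pmax)] forces [gamma > x]. *)
Lemma ccdf_sinr_ge (x : R) : 0 < x ->
  (((1 - expR (- h0 / hbar)) * gain_tail (x / Pmax))%:E <= ccdf gamma x)%E.
Proof.
move=> x0.
have mH : measurable (h @^-1` `]-oo, h0]) by exact: measurable_funPTI.
have mH0 : measurable (h @^-1` `]-oo, 0]) by exact: measurable_funPTI.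
have mg : measurable (gamma @^-1` `]x, +oo[) by exact: measurable_funPTI.
rewrite EFinM -(exponential_RV_le exp_h h0_gt0).
rewrite -(@prob_gain_event _ `]-oo, h0]) ?divr_gt0//.
(* Adding the null event [h <= 0] to the right side absorbs the outcomes where the first ratio has a
   nonpositive or zero denominator. *)
rewrite -[leRHS](@measureU0 _ _ _ P _ _ mg mH0 (exponential_RV_le0 exp_h)).
apply: le_measure; rewrite ?inE.
- by apply: measurableI => //; exact: measurable_gain_event.
- exact: measurableU.
move=> w [/=]; rewrite !in_itv/= andbT => hh0 [qw0 xg].
have [hw0|hw0] := leP (h w) 0; [by right|left].
have I0 := inter_gt0 qw0.
rewrite lt_min; apply/andP; split; last first.
  by rewrite ltr_pdivlMr// -ltr_pdivrMl// mulrA [_^-1 * x]mulrC.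
rewrite ltr_pdivlMr ?mulr_gt0//.
apply: (@le_lt_trans _ _ (Q * (x / Pmax * (Pp * q w + sigma2)))).
  rewrite (_ : Q * _ = x * (h0 * (Pp * q w + sigma2))); last by rewrite /h0; ring.
  by rewrite ler_pM2l// ler_pM2r.
by rewrite ltr_pM2l.
Qed.

(* Above [h0 + t] the gain [h] may be replaced by [h0 + t] in the first ratio. *)
Lemma ccdf_sinr_le (x t : R) : 0 < x -> 0 < t ->
  (ccdf gamma x <= ((1 - expR (- (h0 + t) / hbar)) * gain_tail (x / Pmax)
                    + gain_tail (x * (h0 + t) / Q))%:E)%E.
Proof.
move=> x0 t0.
have ht0 : 0 < h0 + t by exact: addr_gt0.
have mH : measurable (h @^-1` `]-oo, h0 + t]) by exact: measurable_funPTI.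
have mq0 : measurable (q @^-1` `]-oo, 0[) by exact: measurable_funPTI.
have mg : measurable (gamma @^-1` `]x, +oo[) by exact: measurable_funPTI.
have mG := measurable_gain_event.
rewrite EFinD EFinM -(exponential_RV_le exp_h ht0).
rewrite -(@prob_gain_event _ `]-oo, h0 + t]) ?divr_gt0//.
have -> : (gain_tail (x * (h0 + t) / Q))%:E = P (gain_event (x * (h0 + t) / Q)).
  have s0 : 0 < x * (h0 + t) / Q by rewrite divr_gt0// mulr_gt0.
  have := prob_gain_event s0 (@measurableT _ R).
  by rewrite preimage_setT setTI probability_setT mul1e.
set E1 := _ `&` _; set E2 := gain_event (_ / Q).
have mE1 : measurable E1 by apply: measurableI => //; exact: mG.
have mE : measurable (E1 `|` E2) by apply: measurableU => //; exact: mG.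
apply: le_trans (measureU2 _ mE1 (mG _)).
(* The null event [q < 0] is added because [gain_event] excludes it. *)
rewrite -[leRHS](@measureU0 _ _ _ P _ _ mE mq0 (exponential_RV_lt0 exp_q)).
rewrite -[leLHS]/(P (gamma @^-1` `]x, +oo[)).
apply: le_measure; rewrite ?inE//; first exact: measurableU.
move=> w /=; rewrite !in_itv/= andbT lt_min => /andP[xQ xPmax].
have [qw0|qw0] := ltP (q w) 0; [by right|left].
have I0 := inter_gt0 qw0.
have [hw|hw] := leP (h w) (h0 + t); [left|right]; split => //=.
- split => //; move: xPmax.
  by rewrite ltr_pdivlMr// -ltr_pdivrMl// mulrA [_^-1 * x]mulrC.
- move: xQ; rewrite ltr_pdivlMr ?mulr_gt0// ?(lt_trans ht0 hw)// => xQ.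
  rewrite -(ltr_pM2l Q_gt0); apply: le_lt_trans xQ.
  rewrite (_ : Q * _ = x * ((h0 + t) * (Pp * q w + sigma2))).
    by rewrite ler_pM2l// ler_pM2r// ltW.
  by field; rewrite gt_eqF.
Qed.

Lemma cvg_tail_sinr :
  x * expR (sigma2 / (gbar * Pmax) * x) * (1 - fine (cdf gamma x)) @[x --> +oo]
  --> (1 - expR (- h0 / hbar)) / (Pp * qbar / (gbar * Pmax)).
Proof.
set l := sigma2 / _; set c := Pp * qbar / _.
(* [v x] is what remains of [x * e^(l x) * gain_tail (x / Pmax)] once the exponentials cancel. *)
pose v x : R := x / (1 + c * x).
(* With [t = 1 / sqrt x], the exponent in [gain_tail (x * (h0 + t) / Q)] is [-(l x + k sqrt x)], so
   multiplying by [e^(l x)] leaves [e^(-k sqrt x)]. *)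
pose k := sigma2 / (Q * gbar).
have c0 : 0 < c by rewrite divr_gt0// mulr_gt0.
have k0 : 0 < k by rewrite divr_gt0// mulr_gt0.
have sqrty : Num.sqrt x @[x --> +oo] --> (+oo : set_system R).
  apply/cvgryPge => A; near=> x.
  apply: (le_trans (ler_norm A)); rewrite -sqrtr_sqr; apply: ler_wsqrtr.
  by near: x; apply: nbhs_pinfty_ge; exact: num_real.
have vc : v x @[x --> +oo] --> c^-1.
  have : (x^-1 + c)^-1 @[x --> +oo] --> (0 + c)^-1.
    apply: cvgV; first by rewrite add0r gt_eqF.
    apply: cvgD; last exact: cvg_cst.
    apply/gtr0_cvgV0; last exact: cvg_id.
    by apply: nbhs_pinfty_gt; exact: num_real.
  rewrite add0r; apply: cvg_trans; apply: near_eq_cvg; near=> x.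
  have x0 : 0 < x by near: x; apply: nbhs_pinfty_gt; exact: num_real.
  by rewrite /v; field; rewrite !gt_eqF// addr_gt0// mulr_gt0.
have tailE x : 1 - fine (cdf gamma x) = fine (ccdf gamma x).
  by rewrite ccdf_1_cdf fineB ?fin_num_measure.
under eq_fun do rewrite tailE.
apply: (@squeeze_cvgr _ _ _ _ (fun x => (1 - expR (- h0 / hbar)) * v x)
  (fun x => (1 - expR (- (h0 + (Num.sqrt x)^-1) / hbar)) * v x
            + expR (- (k * Num.sqrt x)) * v x)).
- near=> x.
  have x0 : 0 < x by near: x; apply: nbhs_pinfty_gt; exact: num_real.
  have sx0 : 0 < Num.sqrt x by rewrite sqrtr_gt0.
  have D0 : 0 < 1 + c * x by rewrite addr_gt0// mulr_gt0.
  have w0 : 0 < x * expR (l * x) by rewrite mulr_gt0// expR_gt0.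
  have main : x * expR (l * x) * gain_tail (x / Pmax) = v x.
    rewrite /gain_tail /v -mulrA [_ * (_ / _)]mulrA -expRD.
    rewrite (_ : l * x + _ = 0) ?expR0 ?mul1r.
      by congr (_ / (1 + _)); rewrite /c; field; rewrite !gt_eqF.
    by rewrite /l; field; rewrite !gt_eqF.
  have rest : x * expR (l * x) * gain_tail (x * (h0 + (Num.sqrt x)^-1) / Q)
      <= expR (- (k * Num.sqrt x)) * v x.
    rewrite /gain_tail /v -mulrA [expR _ * (_ / _)]mulrA -expRD mulrCA.
    have -> : l * x - x * (h0 + (Num.sqrt x)^-1) / Q * sigma2 / gbar
        = - (k * Num.sqrt x).
      rewrite /l /h0 /k; move: (Num.sqrt x) sx0 (sqr_sqrtr (ltW x0)) => r r0 <-.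
      by field; rewrite !gt_eqF.
    rewrite ler_pM2l ?expR_gt0// ler_pM2l//.
    (* Dropping [1 / sqrt x] from the Laplace denominator turns it into [1 + c * x] and only
       enlarges the fraction. *)
    rewrite lef_pV2 ?posrE//; last first.
      by rewrite addr_gt0// !mulr_gt0 ?invr_gt0 ?addr_gt0 ?invr_gt0.
    rewrite lerD2l.
    have -> : c * x = x * h0 / Q * Pp / gbar * qbar.
      by rewrite /c /h0; field; rewrite !gt_eqF.
    rewrite !ler_pM2r ?invr_gt0// ler_pM2l//.
    by rewrite lerDl ltW// invr_gt0.
  have r0 : 0 < (Num.sqrt x)^-1 by rewrite invr_gt0.
  have := ccdf_sinr_ge x0; have := ccdf_sinr_le x0 r0.
  have ccdf_fin : ccdf gamma x \is a fin_num by exact: fin_num_measure.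
  rewrite -(fineK ccdf_fin) !lee_fin => le ge; apply/andP; split.
    by rewrite -main mulrCA ler_pM2l.
  move: le; rewrite -(ler_pM2l w0) => /le_trans; apply.
  by rewrite mulrDr mulrCA main lerD2l.
- by apply: cvgM vc; exact: cvg_cst.
- rewrite -[X in _ --> X]addr0 -[X in _ --> _ + X](mul0r c^-1).
  have sqrtV0 : (Num.sqrt x)^-1 @[x --> +oo] --> (0 : R).
    apply/gtr0_cvgV0 => //; near=> x; rewrite sqrtr_gt0.
    by near: x; apply: nbhs_pinfty_gt; exact: num_real.
  apply: cvgD; apply: cvgM vc.
    apply: cvgB; first exact: cvg_cst.
    apply: continuous_cvg; first exact: continuous_expR.
    apply: cvgM; last exact: cvg_cst.
    rewrite -[X in _ --> - X]addr0; apply: cvgN.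
    by apply: cvgD => //; exact: cvg_cst.
  apply: (@cvg_comp _ _ _ _ (fun y => expR (- y)) _ (pinfty_nbhs R));
    last exact: cvgr_expR.
  exact: gt0_cvgMry.
Unshelve. all: end_near. Qed.

End sinr_tail.

Theorem proposition1 (d : measure_display) (T : measurableType d)
    (R : realType) (P : probability T R)
    (Q Pmax Pp sigma2 gbar hbar qbar : R)
    (Q_gt0 : 0 < Q) (Pmax_gt0 : 0 < Pmax) (Pp_gt0 : 0 < Pp)
    (sigma2_gt0 : 0 < sigma2)
    (gbar_gt0 : 0 < gbar) (hbar_gt0 : 0 < hbar) (qbar_gt0 : 0 < qbar)
    (g h q : {RV P >-> R})
    (exp_g : exponential_RV g gbar) (exp_h : exponential_RV h hbar)
    (exp_q : exponential_RV q qbar)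
    (ghq_indep : mutually_independent_RVs [tuple g; h; q]) :
  let gamma : {RV P >-> R} := sinr Q Pmax Pp sigma2 g h q in
  gumbel_max_domain (fun x => fine (cdf gamma x)).
Proof.
move=> gamma.
have tail : x * expR (sigma2 / (gbar * Pmax) * x) * (1 - fine (cdf gamma x))
    @[x --> +oo] -->
    (1 - expR (- (Q / Pmax) / hbar)) / (Pp * qbar / (gbar * Pmax)).
  exact: cvg_tail_sinr.
apply: gumbel_max_domain_tail tail; first by rewrite divr_gt0// mulr_gt0.
  (* The limit is positive because [h <= Q / Pmax] has positive probability. *)
  rewrite divr_gt0// ?mulr_gt0 ?invr_gt0 ?mulr_gt0//.
  by rewrite subr_gt0 expR_lt1 mulNr oppr_lt0 !divr_gt0.
by move=> x; rewrite -lee_fin fineK ?fin_num_measure//; exact: cdf_le1.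
Qed.
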